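(* Let $G(n)$ denote the number of ordered factorizations of a positive integer $n$ into pairwise coprime integers larger than one, and let $L(x) = \exp(\log x \log_3 x/\log_2 x)$. For every fixed $\beta > 1$, as $x\to\infty$, \[\sum_{n \leq x} G(n)^\beta = \frac{x^\beta}{L(x)^{\beta + o(1)}}.\]
   Context: $\log_k$ denotes the $k$-th iterate of the natural logarithm. *)

(* Defs.v *)
From HB Require Import structures.
From mathcomp Require Import all_boot all_order all_algebra finmap.
From mathcomp Require Import all_classical all_reals all_analysis.

Set Implicit Arguments.
Unset Strict Implicit.
Unset Printing Implicit Defensive.

Import Order.TTheory GRing.Theory Num.Theory.
Import numFieldNormedType.Exports.

Local Open Scope classical_set_scope.

Definition coprime_factorization (n : nat) (s : seq nat) : bool :=
  [&& all (fun d => 1 < d)%N s, pairwise coprime s & (\prod_(d <- s) d == n)%N].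

Definition coprime_factorizations (n : nat) : set (seq nat) :=
  [set s | coprime_factorization n s].

(* [fset_set] sends infinite sets to the empty one, so the counting function
   [G] relies on this lemma to be meaningful. *)
Lemma finite_coprime_factorizations (n : nat) :
  finite_set (coprime_factorizations n).
Proof.
pose f (b : n.-bseq 'I_n.+1) : seq nat := [seq val i | i <- b].
apply: (@sub_finite_set _ _ (f @` setT)); last exact/finite_image/finite_finset.
move=> s /and3P[s1 _ /eqP sn].
have prod_gt (t : seq nat) :
    all (fun d => 1 < d)%N t -> (size t < \prod_(d <- t) d)%N.
  elim: t => [|a t IH] /=; first by rewrite big_nil.
  case/andP=> a1 /IH h; rewrite big_cons.
  apply: leq_trans (leq_mul a1 (leqnn _)).
  by rewrite mul2n -addnn -addn1 addnC leq_add // (leq_ltn_trans _ h).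
have sz : (size s <= n)%N by rewrite -sn ltnW // prod_gt.
have n0 : (0 < n)%N by rewrite -sn (leq_ltn_trans _ (prod_gt _ s1)).
have sle d : d \in s -> (d < n.+1)%N.
  move=> ds; rewrite ltnS dvdn_leq // -sn (big_rem d ds) /=.
  exact: dvdn_mulr.
have sz' : (size [seq (inord d : 'I_n.+1) | d <- s] <= n)%N by rewrite size_map.
exists (Bseq sz') => //; rewrite /f /= -map_comp -[RHS]map_id.
by apply/eq_in_map => d /sle dn /=; rewrite inordK.
Qed.

(* Here [G 1 = 1], the empty product being a factorization of [1]. *)
Definition G (n : nat) : nat := #|` fset_set (coprime_factorizations n)|.

Local Open Scope ring_scope.

Definition logk (R : realType) (k : nat) (x : R) : R := iter k (@ln R) x.

Definition L (R : realType) (x : R) : R :=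
  expR (ln x * logk 3 x / logk 2 x).

(* Main.v *)
(** If [n] has [k] distinct primes, then [k! <= G n <= (k + 1)^k], since [G n] counts
    the ordered set partitions of a [k]-element set.  Write [l = ln x], and [l2],
    [l3] for the next iterated logarithms, so that [ln L(x) = l * l3 / l2].

    Lower bound: Chebyshev gives [k ~ l / l2] primes below [5 l]; their product
    [n] is at most [x], and [ln k! = l - (1 + o(1)) l l3 / l2].

    Upper bound (Rankin): for [s > 1] and [Y ~ l], the Euler product bounds
    [\sum_n Y^(s omega(n)) n^-s] by [expR (O(Y / ln Y))], which is [L(x)^o(1)].
    Since [k! <= n], every [n <= x] has at most [(1 + o(1)) l / l2] primes; those
    with nearly that many are compared with the sum for [s = beta], where each
    prime saves a factor [l2], and the others with the sum for some
    [s < beta]. *)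
Require Import Defs.
From mathcomp Require Import all_boot all_order all_algebra finmap.
From mathcomp Require Import all_classical all_reals all_analysis.
From mathcomp Require Import ring lra zify.
Import Order.TTheory GRing.Theory Num.Theory.
Import numFieldNormedType.Exports.
Set Implicit Arguments.
Unset Strict Implicit.
Unset Printing Implicit Defensive.
Local Open Scope classical_set_scope.
Local Open Scope ring_scope.

(** * Factorial bounds for the number of prime factors and for [G] *)

Lemma leq_uniq_fset_set {T : choiceType} (A : set T) (s : seq T) :
  finite_set A -> uniq s -> (forall x, x \in s -> A x) ->
  (size s <= #|` fset_set A|)%N.
Proof.
move=> Af us sA; apply: uniq_leq_size us _ => x /sA Ax.
by change (x \in fset_set A); rewrite in_fset_set ?inE.
Qed.

Lemma coprime_prodr (m : nat) (s : seq nat) :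
  all (coprime m) s -> coprime m (\prod_(i <- s) i).
Proof.
elim: s => [|i s IH] /=; first by rewrite big_nil coprimen1.
by case/andP=> mi /IH ms; rewrite big_cons coprimeMr mi.
Qed.

Lemma prod_primes_dvdn (n : nat) (s : seq nat) :
  uniq s -> all prime s -> all (dvdn^~ n) s -> (\prod_(p <- s) p %| n)%N.
Proof.
elim: s => [|p s IH] /=; first by rewrite big_nil dvd1n.
case/andP=> ps us /andP[pp pps] /andP[pn sn]; rewrite big_cons Gauss_dvd.
  by rewrite pn IH.
apply: coprime_prodr; apply/allP => q qs.
rewrite prime_coprime // dvdn_prime2 // ?(allP pps q)//.
by apply: contra ps => /eqP ->.
Qed.

(** Entry number [i] of an increasing list above [m] is at least [m + 1 + i]. With [m = 0] this
    bounds a factorial by a product of distinct primes. *)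
Lemma leq_prod_sorted (m : nat) (s : seq nat) : path ltn m s ->
  (\prod_(i < size s) (m.+1 + i) <= \prod_(i <- s) i)%N.
Proof.
elim: s m => [|x s IH] m /=; first by rewrite big_ord0 big_nil.
case/andP=> mx /IH xs; rewrite big_cons big_ord_recl addn0.
apply: leq_mul => //; apply: leq_trans xs.
by apply: leq_prod => i _; rewrite /= /bump /= add1n addnS -addSn leq_add2r.
Qed.

Lemma fact_omega_leq (n : nat) : (0 < n)%N -> ((size (primes n))`! <= n)%N.
Proof.
move=> n0; have prod_le : (\prod_(p <- primes n) p <= n)%N.
  apply/dvdn_leq/prod_primes_dvdn => //; first exact: primes_uniq.
    by apply/allP => p; rewrite mem_primes => /andP[].
  by apply/allP => p; rewrite mem_primes => /and3P[].
apply: leq_trans prod_le; rewrite fact_prod big_add1 /= big_mkord.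
apply: (@leq_prod_sorted 0); have := sorted_primes n.
case E: (primes n) => [//|p s] /= ->; rewrite andbT.
have : p \in primes n by rewrite E mem_head.
by rewrite mem_primes => /andP[/prime_gt0].
Qed.

(** Each ordering of the distinct primes in [s] is a coprime factorization of their product. *)
Lemma fact_leq_G (s : seq nat) : uniq s -> all prime s ->
  ((size s)`! <= G (\prod_(p <- s) p))%N.
Proof.
move=> us ps; rewrite -size_permutations //.
apply: leq_uniq_fset_set (permutations_uniq _) _ => [|t].
  exact: finite_coprime_factorizations.
rewrite mem_permutations => st; have pt : all prime t.
  by rewrite (perm_all _ st).
apply/and3P; split; last by rewrite (perm_big _ st).
  by apply: sub_all pt => p; exact: prime_gt1.
have : uniq t by rewrite (perm_uniq st).
elim: t pt {st} => //= p t IH /andP[pp pt] /andP[pnt ut].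
rewrite IH // andbT; apply/allP => q qt.
rewrite prime_coprime // dvdn_prime2 // ?(allP pt q)//.
by apply: contra pnt => /eqP ->.
Qed.

(** * Coprime factorizations as maps on primes, and the upper bound for [G] *)

Section CoprimeFactorization.
Variables (n : nat) (s : seq nat).
Hypothesis ns : coprime_factorization n s.

(** By coprimality a prime of [n] divides exactly one entry of [s]. The map sending it to the
    position of that entry turns out to determine [s]. *)
Local Notation block p := (find (dvdn p) s).

Let s_gt1 : all (fun d => 1 < d)%N s. Proof. by case/and3P: ns. Qed.
Let s_coprime : pairwise coprime s. Proof. by case/and3P: ns. Qed.
Let s_prod : (\prod_(d <- s) d)%N = n. Proof. by case/and3P: ns => _ _ /eqP. Qed.

Lemma coprime_factorization_gt0 : (0 < n)%N.
Proof.
by rewrite -s_prod big_seq prodn_cond_gt0 // => d /(allP s_gt1)/ltnW.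
Qed.

Lemma coprime_nth (i j : nat) : (i < j < size s)%N ->
  coprime (nth 1%N s i) (nth 1%N s j).
Proof.
case/andP=> ij js; apply: (pairwiseP 1%N s_coprime) => //.
by rewrite inE (ltn_trans ij).
Qed.

Lemma block_eq (i p : nat) : prime p -> (i < size s)%N ->
  (p %| nth 1%N s i)%N -> block p = i.
Proof.
move=> pp is_ pi; have le : (block p <= i)%N.
  by rewrite leqNgt; apply/negP => /(before_find 1%N); rewrite pi.
move: le; rewrite leq_eqVlt => /orP[/eqP //|lti].
have hp : has (dvdn p) s by apply/hasP; exists (nth 1%N s i); rewrite ?mem_nth.
have := coprime_nth (i := block p) (j := i); rewrite lti is_ => /(_ isT).
move/(nth_find 1%N) : hp => p1 /eqP g1.
by have := prime_gt1 pp; rewrite ltnNge dvdn_leq // -g1 dvdn_gcd p1.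
Qed.

Lemma has_block (p : nat) : p \in primes n -> (block p < size s)%N.
Proof.
rewrite mem_primes -has_find => /and3P[pp _].
rewrite -s_prod; elim: s => [|d t IH]; first by rewrite big_nil Euclid_dvd1.
by rewrite big_cons Euclid_dvdM //= => /orP[->|/IH ->]; rewrite ?orbT.
Qed.

Lemma nth_gt1 (i : nat) : (i < size s)%N -> (1 < nth 1%N s i)%N.
Proof. by move=> si; apply: (allP s_gt1); rewrite mem_nth. Qed.

Lemma nth_dvdn (i : nat) : (i < size s)%N -> (nth 1%N s i %| n)%N.
Proof.
by move=> si; rewrite -s_prod (big_rem (nth 1%N s i)) ?mem_nth // dvdn_mulr.
Qed.

(** Every entry exceeds one, so the block map reaches every position; the smallest prime factor
    serves as an explicit preimage. *)
Lemma block_pdiv (i : nat) : (i < size s)%N ->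
  pdiv (nth 1%N s i) \in primes n /\ block (pdiv (nth 1%N s i)) = i.
Proof.
move=> si; have pp := pdiv_prime (nth_gt1 si); split; last first.
  by apply: block_eq => //; exact: pdiv_dvd.
rewrite mem_primes pp coprime_factorization_gt0 /=.
exact: dvdn_trans (pdiv_dvd _) (nth_dvdn si).
Qed.

Lemma size_coprime_factorization : (size s <= size (primes n))%N.
Proof.
rewrite -(size_mkseq (fun i => pdiv (nth 1%N s i)) (size s)).
apply: uniq_leq_size => [|p].
  apply/mkseq_uniqP => i j; rewrite !inE => si sj e.
  by rewrite -(block_pdiv si).2 e (block_pdiv sj).2.
by case/mapP => i; rewrite mem_iota add0n => /block_pdiv[h _] ->.
Qed.

(** Let [c] be the product of the other entries. Then [n = d * c] with [d] coprime to [c], so [d] is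
    the [\pi(d)]-part of [n], and a prime of [n] lies in [\pi(d)] exactly when its block is [i]. *)
Lemma nth_coprime_factorization (i : nat) : (i < size s)%N ->
  nth 1%N s i = (n`_[pred p | block p == i])%N.
Proof.
move=> si; set d := nth _ _ _; have n0 := coprime_factorization_gt0.
have d1 : (0 < d)%N := ltnW (nth_gt1 si).
pose c := (\prod_(e <- take i s ++ drop i.+1 s) e)%N.
have nE : n = (d * c)%N.
  rewrite -s_prod -[in LHS](cat_take_drop i s) (drop_nth 1%N si) /c !big_cat /=.
  by rewrite big_cons mulnCA.
have c0 : (0 < c)%N by move: n0; rewrite nE muln_gt0 => /andP[].
have cd : coprime d c.
  move: s_coprime; rewrite -(cat_take_drop i s) (drop_nth 1%N si) pairwise_cat.
  rewrite allrel_consr /= => /and4P[/andP[h _] _ h' _].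
  by rewrite /c big_cat coprimeMr !coprime_prodr // (sub_all _ h) // => e;
     rewrite coprime_sym.
have dE p : p \in \pi(n) -> (p \in \pi(d)) = (block p == i).
  rewrite mem_primes => /[dup] pn /and3P[pp _ _].
  apply/idP/eqP => [|bp].
    by rewrite mem_primes => /and3P[_ _ pd]; exact: block_eq.
  rewrite mem_primes pp d1 /= /d -bp; apply: nth_find.
  by rewrite has_find has_block // mem_primes.
have -> : (n`_[pred p | block p == i])%N = (n`_\pi(d))%N.
  by apply: eq_in_partn => p pn; rewrite dE.
rewrite {1}nE partnM // part_pnat_id ?pnat_pi // part_p'nat ?muln1 //.
by rewrite -coprime_pi'.
Qed.

End CoprimeFactorization.

Lemma coprime_factorization_inj (n : nat) (s t : seq nat) :
  coprime_factorization n s -> coprime_factorization n t ->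
  {in primes n, forall p, find (dvdn p) s = find (dvdn p) t} -> s = t.
Proof.
wlog le_st : s t / (size s <= size t)%N.
  move=> W ns nt st; case: (leqP (size s) (size t)) => [le|/ltnW le].
    exact: W.
  by apply/esym/W => // p /st.
move=> ns nt st; have sz : size s = size t.
  apply/eqP; rewrite eqn_leq le_st leqNgt; apply/negP => lt.
  (* If [t] were longer, a prime dividing its entry at position [size s] would have an out-of-range
     block in [s]. *)
  have [pn bp] := block_pdiv nt lt.
  by have := has_block ns pn; rewrite st // bp ltnn.
apply: (eq_from_nth (x0 := 1%N)) => // i si.
rewrite (nth_coprime_factorization ns) // (nth_coprime_factorization nt) -?sz //.
by apply: eq_in_partn => p pn; rewrite !inE st.
Qed.

(** A factorization is encoded by its block map on the [k] primes of [n]. Its values are at most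
    [size s <= k], so [inord] into ['I_k.+1] loses nothing. *)
Lemma G_leq (n : nat) :
  (G n <= (size (primes n)).+1 ^ size (primes n))%N.
Proof.
set k := size (primes n).
pose code (s : seq nat) : {ffun 'I_k -> 'I_k.+1} :=
  [ffun i : 'I_k => inord (find (dvdn (nth 0%N (primes n) i)) s)].
have memA s : s \in fset_set (coprime_factorizations n) ->
    coprime_factorization n s.
  by rewrite in_fset_set ?inE //; exact: finite_coprime_factorizations.
have code_inj : {in enum_fset (fset_set (coprime_factorizations n)) &,
    injective code}.
  move=> s t /memA ns /memA nt /ffunP st.
  apply: (coprime_factorization_inj ns nt) => p pn.
  have ik : (index p (primes n) < k)%N by rewrite index_mem.
  have := congr1 val (st (Ordinal ik)).
  rewrite !ffunE /= nth_index // !inordK //.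
    by rewrite ltnS (leq_trans (find_size _ _)) ?(size_coprime_factorization nt).
  by rewrite ltnS (leq_trans (find_size _ _)) ?(size_coprime_factorization ns).
have -> : (k.+1 ^ k)%N = #|{ffun 'I_k -> 'I_k.+1}| by rewrite card_ffun !card_ord.
rewrite /G -(size_map code) cardE; apply: uniq_leq_size => [|f _]; last first.
  by rewrite mem_enum.
by rewrite map_inj_in_uniq ?fset_uniq.
Qed.

(** * Chebyshev bounds for the prime counting function *)

Lemma prime_dvd_fact (p n : nat) : prime p -> (p %| n`!)%N = (p <= n)%N.
Proof.
move=> pp; apply/idP/idP => [|pn]; last by rewrite dvdn_fact // prime_gt0.
elim: n => [|n IH]; first by rewrite fact0 Euclid_dvd1.
rewrite factS Euclid_dvdM // => /orP[/dvdn_leq -> //|/IH/leq_trans -> //].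
Qed.

Lemma leq_bin_exp (n m : nat) : ('C(n, m) <= 2 ^ n)%N.
Proof.
elim: n m => [|n IH] [|m] //; first by rewrite bin0 expn_gt0.
by rewrite binS expnS mul2n -addnn leq_add.
Qed.

(* Halving with rounding up, [n <= 2 m] with [m = uphalf n], costs [16] instead
   of the usual [4]. *)
Lemma prod_primes_leq (n : nat) :
  (\prod_(0 <= p < n.+1 | prime p) p <= 16 ^ n)%N.
Proof.
elim/ltn_ind: n => n IH.
case: (leqP n 1) => [|n1].
  by case: n IH => [|[|]] // _ _; rewrite ?big_nat_recr //= big_mkcond /=
    !big_nat_recr //= big_geq.
pose m := uphalf n; have mn : (m < n)%N by rewrite /m; lia.
(* The primes in [(m, 2 m]] contribute at most [4 ^ m] and the smaller ones [16 ^ m], together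
   [4 ^ (3 * m)], to be compared with [16 ^ n = 4 ^ (2 * n)]. *)
have m2n : (3 * m <= 2 * n)%N by rewrite /m; lia.
have n2m : (n <= m.*2)%N by rewrite /m; lia.
apply: (@leq_trans (\prod_(0 <= p < m.*2.+1 | prime p) p)).
  rewrite [X in (_ <= X)%N](@big_cat_nat _ _ _ n.+1) //= leq_pmulr //.
  by apply: prodn_cond_gt0 => p /prime_gt0.
rewrite (@big_cat_nat _ _ _ m.+1) //=; last by lia.
have -> : (16 = 4 ^ 2)%N by [].
rewrite -expnM; apply: leq_trans (leq_pexp2l _ m2n) => //.
rewrite mulSn expnD mulnC; apply: leq_mul; last first.
  by apply: leq_trans (IH m mn) _; rewrite (_ : 16 = 4 ^ 2)%N // -expnM mulnC.
(* A prime in [(m, 2 m]] divides [(2 m)!] but not [m!], hence divides the central binomial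
   coefficient. *)
apply: (@leq_trans 'C(m.*2, m)); last first.
  by rewrite (leq_trans (leq_bin_exp _ _)) // -muln2 mulnC expnM.
rewrite -big_filter; apply: dvdn_leq; first by rewrite bin_gt0; lia.
apply: prod_primes_dvdn.
- by rewrite filter_uniq // iota_uniq.
- by apply/allP => p; rewrite mem_filter => /andP[].
apply/allP => p; rewrite mem_filter mem_index_iota => /andP[pp /andP[mp pm]].
have : (p %| m.*2`!)%N by rewrite prime_dvd_fact.
rewrite -(@bin_fact m.*2 m); last by lia.
have -> : (m.*2 - m = m)%N by lia.
by rewrite !Euclid_dvdM // !prime_dvd_fact // leqNgt mp orbb orbF.
Qed.

Definition primepi (n : nat) : nat := size (seq.filter prime (iota 0 n.+1)).

(** At most [m] primes lie below [m]; each of the others contributes a factor of at least [m] to the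
    product of the primes up to [n]. *)
Lemma expn_primepi_leq (m n : nat) : (0 < m)%N ->
  (m ^ (primepi n - m) <= 16 ^ n)%N.
Proof.
move=> m0; apply: leq_trans (prod_primes_leq n); rewrite -big_filter.
rewrite /index_iota subn0.
set s := seq.filter _ _; rewrite -[primepi n]/(size s).
have us : uniq s by rewrite filter_uniq // iota_uniq.
have ps : all prime s by rewrite filter_all.
rewrite -(perm_big _ (permEl (perm_filterC (fun p => (p < m)%N) s))) big_cat /=.
apply: (@leq_trans (\prod_(p <- seq.filter (fun p => ~~ (p < m)%N) s) p)); last first.
  rewrite leq_pmull // big_seq prodn_cond_gt0 // => p.
  by rewrite mem_filter => /andP[_ /(allP ps)/prime_gt0].
rewrite -[X in (X <= _)%N]mul1n big_filter.
apply: (@leq_trans (m ^ count (fun p => ~~ (p < m)%N) s)).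
  rewrite mul1n leq_pexp2l // -(count_predC (fun p => (p < m)%N) s).
  rewrite leq_subLR leq_add2r -size_filter -[X in (_ <= X)%N](size_iota 0).
  apply: uniq_leq_size; first by rewrite filter_uniq.
  by move=> p; rewrite mem_filter mem_iota => /andP[].
rewrite -big_filter -size_filter.
elim: s {us ps} => [|p s IH] /=; first by rewrite big_nil.
case: (leqP m p) => //= mp; rewrite big_cons expnS; exact: leq_mul.
Qed.

Lemma logn_fact_log (p n T : nat) : prime p -> (n < p ^ T.+1)%N ->
  logn p n`! = (\sum_(1 <= k < T.+1) n %/ p ^ k)%N.
Proof.
move=> pp nT; rewrite logn_fact //.
have big0 U V : (n < p ^ U.+1)%N -> (U <= V)%N ->
    (\sum_(1 <= k < V.+1) n %/ p ^ k = \sum_(1 <= k < U.+1) n %/ p ^ k)%N.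
  move=> nU UV; rewrite (@big_cat_nat _ _ _ U.+1) //=.
  rewrite [X in (_ + X)%N]big_nat_cond [X in (_ + X)%N]big1 ?addn0 // => k.
  rewrite andbT => /andP[Uk _]; rewrite divn_small // (leq_trans nU) //.
  by rewrite leq_pexp2l // prime_gt0.
have nn : (n < p ^ n.+1)%N.
  by rewrite (ltn_trans (ltnSn n)) // ltn_expl // prime_gt1.
by case: (leqP n T) => [|/ltnW] nT'; rewrite -1?(big0 _ _ nn nT') ?(big0 _ _ nT nT').
Qed.

(** In Legendre's formula for [(2 n)! / (n! * n!)] each power [p ^ k] contributes at most one, and
    only the [k] with [p ^ k <= 2 n] contribute. *)
Lemma pfactor_bin_leq (p n : nat) : prime p -> (0 < n)%N ->
  (p ^ logn p 'C(n.*2, n) <= n.*2)%N.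
Proof.
move=> pp n0; have p1 := prime_gt1 pp.
pose T := trunc_log p n.*2.
have nT : (n.*2 < p ^ T.+1)%N by apply: trunc_log_ltn.
have nT' : (n < p ^ T.+1)%N by apply: leq_ltn_trans nT; lia.
apply: (@leq_trans (p ^ T)); last by apply: trunc_logP => //; lia.
rewrite leq_pexp2l ?prime_gt0 //.
have C0 : (0 < 'C(n.*2, n))%N by rewrite bin_gt0; lia.
have := @bin_fact n.*2 n; have -> : (n.*2 - n = n)%N by lia.
move/(_ _)/(congr1 (logn p)) => H.
have {H} := H ltac:(lia).
rewrite !lognM ?muln_gt0 ?fact_gt0 // (logn_fact_log pp nT) (logn_fact_log pp nT').
have le : (\sum_(1 <= k < T.+1) n.*2 %/ p ^ k <=
   \sum_(1 <= k < T.+1) (n %/ p ^ k + n %/ p ^ k + 1))%N.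
  apply: leq_sum => k _; have pk : (0 < p ^ k)%N by rewrite expn_gt0 prime_gt0.
  rewrite -ltnS ltn_divLR //.
  have := ltn_pmod n pk; have := divn_eq n (p ^ k).
  by set a := (_ %/ _)%N; set b := (_ %% _)%N; set q := (p ^ k)%N; nia.
rewrite !big_split /= sum_nat_const_nat muln1 in le; lia.
Qed.

Lemma exp2_leq_bin (n : nat) : (2 ^ n <= 'C(n.*2, n))%N.
Proof.
have fact2 : (2 ^ n * (n`! * n`!) <= n.*2`!)%N.
  elim: n => // n IH; rewrite doubleS !factS expnS.
  apply: (@leq_trans (n.*2.+2 * n.*2.+1 * (2 ^ n * (n`! * n`!)))%N).
    set a := (2 ^ n)%N; set b := n`!; nia.
  by rewrite -mulnA leq_mul2l leq_mul2l IH !orbT.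
have := @bin_fact n.*2 n; have -> : (n.*2 - n = n)%N by lia.
move/(_ ltac:(lia)) => H; rewrite -H leq_pmul2r // in fact2.
by rewrite muln_gt0 fact_gt0.
Qed.

(** The central binomial coefficient is at least [2 ^ n], and is a product of at most [primepi n.*2]
    prime powers, none above [2 n]. *)
Lemma exp2_leq_primepi (n : nat) : (0 < n)%N ->
  (2 ^ n <= n.*2 ^ primepi n.*2)%N.
Proof.
move=> n0; apply: leq_trans (exp2_leq_bin n) _.
have C0 : (0 < 'C(n.*2, n))%N by rewrite bin_gt0; lia.
rewrite {1}(prod_prime_decomp C0) prime_decompE big_map /=.
apply: (@leq_trans (n.*2 ^ size (primes 'C(n.*2, n)))).
  have : all prime (primes 'C(n.*2, n)).
    by apply/allP => p; rewrite mem_primes => /andP[].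
  elim: (primes _) => [|p s IH] /=; first by rewrite big_nil.
  case/andP=> pp ps; rewrite big_cons expnS leq_mul ?pfactor_bin_leq //.
  exact: IH.
rewrite leq_pexp2l ?double_gt0 //; apply: uniq_leq_size (primes_uniq _) _ => p.
rewrite mem_primes mem_filter mem_iota => /and3P[pp _ pC].
rewrite pp /= add0n ltnS -prime_dvd_fact // -(@bin_fact _ n) ?dvdn_mulr //; lia.
Qed.

(** * An Euler product bound for sums weighted by the number of prime factors *)

Lemma mem_primesM (p m q : nat) : prime p -> (0 < m)%N ->
  (q \in primes (p * m)) = (q == p) || (q \in primes m).
Proof.
by move=> pp m0; rewrite primesM ?(prime_gt0 pp) // primes_prime // inE.
Qed.

Lemma omegaM_prime (p m : nat) : prime p -> (0 < m)%N ->
  size (primes (p * m)) = (~~ (p %| m)%N + size (primes m))%N.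
Proof.
move=> pp m0.
have pE : (p \in primes m) = (p %| m)%N by rewrite mem_primes pp m0.
have [pm|pm] := boolP (p %| m)%N.
  rewrite add0n; apply/perm_size/uniq_perm; rewrite ?primes_uniq // => q.
  by rewrite mem_primesM //; case: eqVneq => // ->; rewrite pE pm.
rewrite -[RHS]/(size (p :: primes m)); apply/perm_size/uniq_perm.
- exact: primes_uniq.
- by rewrite /= pE pm primes_uniq.
by move=> q; rewrite mem_primesM ?inE.
Qed.

Lemma sum_dvdn_leq {R : realType} (p N : nat) (h : nat -> R) : (0 < p)%N ->
  (forall m, 0 <= h m) ->
  \sum_(1 <= n < N.+1 | (p %| n)%N) h (n %/ p)%N <= \sum_(1 <= m < N.+1) h m.
Proof.
move=> p0 h0.
have -> : \sum_(1 <= n < N.+1 | (p %| n)%N) h (n %/ p)%N =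
    \sum_(1 <= m < (N %/ p).+1) h m.
  elim: N => [|N IH]; first by rewrite div0n !big_geq.
  rewrite big_mkcond big_nat_recr //= -big_mkcond /= IH divnS //.
  by case: (p %| N.+1)%N; rewrite ?addr0 // add1n [RHS]big_nat_recr.
rewrite [leRHS](@big_cat_nat _ _ _ (N %/ p).+1) ?ltnS ?leq_div //=.
by rewrite lerDl sumr_ge0.
Qed.

Section EulerProduct.
Variables (R : realType) (z s : R) (N : nat).
Hypotheses (z_ge0 : 0 <= z) (s_ge1 : 1 <= s).

Local Notation f n := (z ^+ size (primes n) * n%:R `^ (- s)).
Local Notation smooth j n := (all (fun p => p <= j)%N (primes n)).
Local Notation S j := (\sum_(1 <= n < N.+1 | smooth j n) f n).

Let f_ge0 (n : nat) : 0 <= f n.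
Proof. by rewrite mulr_ge0 ?exprn_ge0 ?powR_ge0. Qed.

Lemma powRN_prime_leq (p : nat) : prime p -> p%:R `^ (- s) <= 2^-1 :> R.
Proof.
move=> /prime_gt1 p1; have p1R : 1 <= p%:R :> R by rewrite ler1n ltnW.
have h : 2 <= p%:R `^ s.
  apply: (@le_trans _ _ (p%:R `^ 1)); last exact: ler_powR.
  by rewrite powRr1 ?ler0n // ler_nat.
by rewrite powRN lef_pV2 // posrE // (lt_le_trans _ h).
Qed.

Lemma weightM_prime (p m : nat) : prime p -> (0 < m)%N ->
  f (p * m)%N = p%:R `^ (- s) * (if (p %| m)%N then 1 else z) * f m.
Proof.
move=> pp m0; rewrite omegaM_prime // natrM powRM //.
by case: (p %| m)%N; rewrite /= ?add0n ?add1n ?exprS; ring.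
Qed.

(* If [D] is the sum over the new integers [n], those divisible by [p], then
   writing [n = p * m] gives [D <= q (D + z * S)] with [q = p^-s <= 1/2]. *)
Lemma smooth_sum_prime (j : nat) : prime j.+1 ->
  S j.+1 <= S j * (1 + 2 * z * j.+1%:R `^ (- s)).
Proof.
set p := j.+1 => pp; set q := p%:R `^ (- s).
have q0 : 0 <= q by exact: powR_ge0.
have q2 : q <= 2^-1 := powRN_prime_leq pp.
have smoothE n : (0 < n)%N -> smooth j n = smooth p n && ~~ (p %| n)%N.
  move=> n0; apply/allP/andP => [h|[/allP h pn] r rn].
    split; first by apply/allP => r /h /leqW.
    apply/negP => pn; have /h : p \in primes n by rewrite mem_primes pp n0.
    by rewrite ltnn.
  have := h r rn; rewrite leq_eqVlt ltnS => /orP[/eqP rp|//].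
  by move: rn; rewrite rp mem_primes => /and3P[_ _]; rewrite (negPf pn).
pose D := \sum_(1 <= n < N.+1 | smooth p n && (p %| n)%N) f n.
have SE : S p = D + S j.
  rewrite (bigID (fun n => p %| n)%N) /= -/D; congr (_ + _).
  rewrite big_nat_cond [RHS]big_nat_cond; apply: eq_bigl => n.
  by case: (ltnP 0 n) => //= n0; rewrite smoothE.
have S0 : 0 <= S j by rewrite sumr_ge0.
have le : D <= q * D + z * q * S j.
  (* By [weightM_prime], [h m] is [f (p * m)] when [m > 0] is [p]-smooth, so [D] is bounded by a sum
     of [h] over the quotients by [p]. *)
  pose h m := if smooth p m then
    q * (if (p %| m)%N then 1 else z) * f m else 0.
  have h0 m : 0 <= h m.
    by rewrite /h; case: ifP => // _; apply: mulr_ge0 => //; apply: mulr_ge0 => //;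
      case: ifP.
  apply: (@le_trans _ _ (\sum_(1 <= n < N.+1 | (p %| n)%N) h (n %/ p)%N)).
    rewrite /D big_mkcond [leRHS]big_mkcond; apply: ler_sum_nat => n /andP[n0 _].
    case: ifP => [/andP[sn pn]|_]; last by case: ifP.
    rewrite pn; have [m nE] := dvdnP pn; rewrite nE mulnK // mulnC in sn n0 *.
    move: n0; rewrite muln_gt0 => /andP[_ m0].
    rewrite /h ifT ?weightM_prime //.
    by apply/allP => r rm; apply: (allP sn); rewrite mem_primesM // rm orbT.
  apply: le_trans (sum_dvdn_leq _ _ h0) _ => //.
  rewrite le_eqVlt; apply/orP; left; apply/eqP.
  rewrite /h -big_mkcond /= (bigID (fun n => p %| n)%N) /=; congr (_ + _).
    rewrite /D big_distrr; apply: eq_bigr => n /andP[_ ->] /=; ring.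
  rewrite big_distrr big_nat_cond [RHS]big_nat_cond; apply: congr_big => // n.
    by case: (ltnP 0 n) => //= n0; rewrite smoothE.
  by case/and3P=> _ _ /negPf -> /=; ring.
have qD : D <= 2 * (z * q * S j).
  have D0 : 0 <= D by rewrite sumr_ge0.
  by nra.
by rewrite SE; lra.
Qed.

(** Induction on the smoothness bound: only [n = 1] is [0]-smooth, and raising the bound from [j] to
    [j.+1] admits new integers only if [j.+1] is prime. *)
Lemma smooth_sum_leq (j : nat) :
  S j <= \prod_(1 <= p < j.+1 | prime p) (1 + 2 * z * p%:R `^ (- s)).
Proof.
elim: j => [|j IH].
  rewrite [leRHS]big_geq //; case: N => [|N']; first by rewrite big_geq.
  rewrite big_mkcond big_ltn //= powR1 mulr1 big_nat_cond big1 ?addr0 // => n.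
  rewrite andbT => /andP[n2 _]; case: ifP => // /allP h.
  have pn : pdiv n \in primes n.
    by rewrite mem_primes pdiv_prime ?pdiv_dvd ?(ltnW n2).
  by have := h _ pn; rewrite leqNgt pdiv_gt0.
rewrite [leRHS]big_mkcond big_nat_recr //= -big_mkcond /=.
case: ifP => [pj|/negP npj].
  apply: le_trans (smooth_sum_prime pj) _.
  by rewrite ler_wpM2r // addr_ge0 // !mulr_ge0 ?powR_ge0.
rewrite mulr1; apply: le_trans IH.
rewrite le_eqVlt; apply/orP; left; apply/eqP/eq_bigl => n.
apply: eq_in_all => p; rewrite mem_primes => /and3P[pp _ _].
by rewrite leq_eqVlt ltnS; case: eqVneq => // pE; rewrite pE in pp.
Qed.

Lemma sum_omega_prod_leq :
  \sum_(1 <= n < N.+1) f n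
    <= \prod_(1 <= p < N.+1 | prime p) (1 + 2 * z * p%:R `^ (- s)).
Proof.
apply: le_trans (smooth_sum_leq N).
rewrite le_eqVlt; apply/orP; left; apply/eqP.
rewrite big_nat [RHS]big_nat_cond; apply: eq_bigl => n.
case: (ltnP 0 n) => //= n0; case: ltnP => //= nN; apply/esym/allP => p.
by rewrite mem_primes => /and3P[_ _ /(dvdn_leq n0) pn]; exact: leq_trans pn _.
Qed.

End EulerProduct.

(** * Elementary estimates for logarithms, power tails and sums over primes *)

Section LogSums.
Variable R : realType.
Implicit Types a b x s : R.

Lemma ln_subr_leq a b : 0 < a -> 0 < b -> ln b - ln a <= (b - a) / a.
Proof.
move=> a0 b0; rewrite -ln_div ?posrE //.
have -> : (b - a) / a = b / a - 1 by field; rewrite gt_eqF.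
have := @le_ln1Dx R (b / a - 1); rewrite addrCA subrr addr0; apply.
by have := divr_gt0 b0 a0; lra.
Qed.

(** A weak Stirling bound, by induction from [k * (ln (k + 1) - ln k) <= 1]. *)
Lemma ln_fact_geq (k : nat) : k%:R * ln k%:R - k%:R <= ln (k`!)%:R :> R.
Proof.
elim: k => [|k IH]; first by rewrite ln1 mul0r subr0.
have [->|k0] := posnP k; first by rewrite factS fact0 mul1n ln1; lra.
have k0' : 0 < k%:R :> R by rewrite ltr0n.
rewrite factS natrM lnM ?posrE ?ltr0n ?fact_gt0 //.
have := ln_subr_leq k0' (ltr0Sn R k); rewrite -!natr1 addrAC subrr add0r.
rewrite -(ler_pM2l k0') mulrA mulr1 divff ?gt_eqF //; lra.
Qed.

Lemma sum_ln_ratio_leq (n : nat) :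
  \sum_(1 <= t < n.+1) (ln n%:R - ln t%:R) <= n%:R :> R.
Proof.
rewrite sumrB sumr_const_nat subSS subn0 -[ln _ *+ _]mulr_natl.
have -> : \sum_(1 <= t < n.+1) ln t%:R = ln (n`!)%:R :> R.
  elim: n => [|n IH]; first by rewrite big_geq // fact0 ln1.
  by rewrite big_nat_recr //= IH factS natrM lnM ?posrE ?ltr0n ?fact_gt0 // addrC.
have := ln_fact_geq n; lra.
Qed.

(** The integral comparison in telescoped form: the induction keeps the term [- n ^ (1 - s)], and
    each step reduces to [1 + x <= expR x]. *)
Lemma sum_powR_tail_leq s (m n : nat) : 1 < s -> (0 < m)%N ->
  \sum_(m.+1 <= t < n.+1) t%:R `^ (- s) <= m%:R `^ (1 - s) / (s - 1) :> R.
Proof.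
move=> s1 m0; have s10 : 0 < s - 1 by lra.
have [nm|/ltnW mn] := leqP n m; first by rewrite big_geq // divr_ge0 ?powR_ge0 // ltW.
apply: (@le_trans _ _ ((m%:R `^ (1 - s) - n%:R `^ (1 - s)) / (s - 1))); last first.
  by rewrite ler_pM2r ?invr_gt0 // gerBl powR_ge0.
elim: n mn => [|n IH]; first by case: m m0.
rewrite leq_eqVlt => /orP[/eqP ->|]; first by rewrite subrr mul0r big_geq.
rewrite ltnS => mn; rewrite big_nat_recr ?ltnS //=.
have := IH mn; have n0 : (0 < n)%N by exact: leq_trans mn.
suff : n.+1%:R `^ (- s) <= (n%:R `^ (1 - s) - n.+1%:R `^ (1 - s)) / (s - 1) :> R.
  rewrite !mulrBl; lra.
set u : R := n.+1%:R; have u0 : 0 < u by rewrite ltr0n.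
have nR0 : 0 < n%:R :> R by rewrite ltr0n.
have nE : n%:R = u - 1 :> R by rewrite /u -natr1 addrK.
rewrite ler_pdivlMr //.
have -> : u `^ (- s) = u `^ (1 - s) / u.
  rewrite powRD; last by rewrite (gt_eqF u0) implybT.
  by rewrite powRr1 ?(ltW u0) // mulrC mulKf // gt_eqF.
have -> : n%:R `^ (1 - s) = u `^ (1 - s) * expR ((s - 1) * (ln u - ln n%:R)).
  rewrite /powR !gt_eqF // -expRD; congr expR; ring.
have h : 1 + (s - 1) / u <= expR ((s - 1) * (ln u - ln n%:R)).
  apply: le_trans (expR_ge1Dx _); rewrite lerD2l ler_pM2l //.
  have := ln_subr_leq u0 nR0; rewrite nE; have -> : (u - 1 - u) / u = - u^-1.
    by field; rewrite gt_eqF.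
  by move=> h; rewrite -lerN2 opprB.
have := @powR_ge0 R u (1 - s); set w := u `^ (1 - s) => w0.
have := ler_wpM2l w0 h; rewrite mulrDr mulr1; set e := expR _.
have -> : w * ((s - 1) / u) = w / u * (s - 1) by ring.
by rewrite lerBrDl.
Qed.

Lemma abel_leq (c h : nat -> R) M (n : nat) :
  (forall t, (0 < t)%N -> h t.+1 <= h t) -> (forall t, 0 <= h t) ->
  (forall k, \sum_(1 <= t < k.+1) c t <= M) ->
  \sum_(1 <= t < n.+1) c t * h t <= M * h 1%N.
Proof.
move=> h_decr h0 cM.
have M0 : 0 <= M by have := cM 0%N; rewrite big_geq.
case: n => [|n]; first by rewrite big_geq // mulr_ge0.
(* The induction needs the slack of the current partial sum, weighted by the last value of [h]; this
   term is nonpositive and is dropped at the end. *)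
suff : \sum_(1 <= t < n.+2) c t * h t <=
    (\sum_(1 <= t < n.+2) c t - M) * h n.+1 + M * h 1%N.
  move/le_trans; apply; rewrite gerDr mulr_le0_ge0 // subr_le0; exact: cM.
elim: n => [|n IH]; first by rewrite !big_nat1; lra.
rewrite big_nat_recr //= [X in (X - M) * _]big_nat_recr //=.
have := cM n.+1; have := h_decr n.+1 isT; have := IH.
set C := \sum_(1 <= t < n.+2) c t; set A := \sum_(1 <= t < n.+2) _ => *.
nra.
Qed.

Lemma primepi_sum (n : nat) :
  \sum_(1 <= t < n.+1) (prime t)%:R = (primepi n)%:R :> R.
Proof.
elim: n => [|n IH]; first by rewrite big_geq.
rewrite big_nat_recr //= IH -natrD /primepi -[in RHS](addn1 n.+1) iotaD.
by rewrite filter_cat size_cat /=; case: prime.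
Qed.

Lemma primepi_leq (m n : nat) : (1 < m)%N ->
  (primepi n)%:R <= m%:R + ln 16 / ln m%:R * n%:R :> R.
Proof.
move=> m1; have lm : 0 < ln m%:R :> R by rewrite ln_gt0 // ltr1n.
have m0 : 0 < m%:R :> R by rewrite ltr0n ltnW.
have h : (primepi n - m)%:R <= n%:R * ln 16 / ln m%:R :> R.
  have := expn_primepi_leq n (ltnW m1).
  rewrite -(ler_nat R) !natrX => le.
  have : ln (m%:R ^+ (primepi n - m)) <= ln (16 ^+ n) :> R.
    by rewrite ler_ln ?posrE ?exprn_gt0.
  by rewrite !lnXn // -[ln m%:R *+ _]mulr_natl -[ln 16 *+ _]mulr_natl -ler_pdivlMr.
have : (primepi n)%:R <= m%:R + (primepi n - m)%:R :> R.
  by rewrite -natrD ler_nat; lia.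
move/le_trans; apply; rewrite lerD2l; apply: le_trans h _.
by rewrite le_eqVlt; apply/orP; left; apply/eqP; ring.
Qed.

(** Abel summation against the prime indicator minus the density [ln 16 / ln m], whose partial sums
    are at most [m] by [primepi_leq]. *)
Lemma sum_prime_leq (m n : nat) (h : nat -> R) : (1 < m)%N ->
  (forall t, (0 < t)%N -> h t.+1 <= h t) -> (forall t, 0 <= h t) ->
  \sum_(1 <= p < n.+1 | prime p) h p <=
    m%:R * h 1%N + ln 16 / ln m%:R * \sum_(1 <= t < n.+1) h t.
Proof.
move=> m1 h_decr h0; set D := _ / _.
have := @abel_leq (fun t => (prime t)%:R - D) h m%:R n h_decr h0.
have cM k : \sum_(1 <= t < k.+1) ((prime t)%:R - D) <= m%:R.
  rewrite sumrB primepi_sum sumr_const_nat subSS subn0 -[D *+ _]mulr_natr.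
  have := primepi_leq k m1; rewrite -/D; lra.
move/(_ cM); under eq_bigr do rewrite mulrBl.
rewrite sumrB -big_distrr /= lerBlDr; apply: le_trans.
rewrite big_mkcond /=; apply: ler_sum_nat => t _.
by case: prime; rewrite ?mul1r ?mul0r.
Qed.

End LogSums.

Lemma ln2_geq (R : realType) : 2^-1 <= ln 2 :> R.
Proof.
have := @ln_subr_leq R 2 1 ltac:(lra) ltac:(lra); rewrite ln1.
have -> : (1 - 2) / 2 = - 2^-1 :> R by field.
lra.
Qed.

(** * The Rankin sum with weight [Y ^ s] per prime factor *)

Section OmegaWeight.
Variables (R : realType) (s : R).
Hypothesis s_gt1 : 1 < s.
Implicit Types Y N : nat.

Let s_ge0 : 0 <= s. Proof. exact/ltW/(lt_trans ltr01). Qed.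

(** The logarithm of the Euler factor at [t] for [z = Y ^ s], a decreasing function to which
    [sum_prime_leq] applies. *)
Local Notation h Y := (fun t : nat => ln (1 + 2 * Y%:R `^ s * t%:R `^ (- s)) : R).

Let h_ge0 Y (t : nat) : 0 <= h Y t.
Proof. by rewrite ln_ge0 // lerDl !mulr_ge0 ?powR_ge0. Qed.

Let h_decr Y (t : nat) : (0 < t)%N -> h Y t.+1 <= h Y t.
Proof.
move=> t0; have p0 (u : nat) : 0 < 1 + 2 * Y%:R `^ s * u%:R `^ (- s) :> R.
  by rewrite ltr_pwDl // !mulr_ge0 ?powR_ge0.
rewrite ler_ln ?posrE // lerD2l ler_wpM2l ?mulr_ge0 ?powR_ge0 // !powRN.
rewrite lef_pV2 ?posrE ?powR_gt0 ?ltr0n //.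
by apply: ge0_ler_powR; rewrite ?nnegrE ?ler0n ?ler_nat ?leqnSn.
Qed.

Lemma ln_weight_leq Y (t : nat) : (0 < t <= Y)%N ->
  h Y t <= ln 3 + s * (ln Y%:R - ln t%:R).
Proof.
case/andP=> t0 tY; have Y0 : (0 < Y)%N by exact: leq_trans tY.
have tR : 0 < t%:R :> R by rewrite ltr0n.
have YR : 0 < Y%:R :> R by rewrite ltr0n.
have E : Y%:R `^ s * t%:R `^ (- s) = expR (s * (ln Y%:R - ln t%:R)) :> R.
  by rewrite /powR !gt_eqF // -expRD; congr expR; ring.
rewrite -mulrA E; set x := s * _.
have x0 : 0 <= x.
  apply: mulr_ge0; first exact: s_ge0.
  by rewrite subr_ge0 ler_ln ?posrE // ler_nat.
have ex : 1 <= expR x by rewrite -expR0 ler_expR.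
rewrite -[leRHS](_ : ln (3 * expR x) = _); last first.
  by rewrite lnM ?posrE ?expR_gt0 // expRK.
rewrite ler_ln ?posrE ?mulr_gt0 ?expR_gt0 //; lra.
Qed.

(** The sum is cut at [Y]. Below, [1 + 2 (Y / t) ^ s <= 3 (Y / t) ^ s] and the Stirling bound give
    [O(Y)]; above, [ln (1 + x) <= x] and the power tail do. *)
Lemma sum_ln_weight_leq Y N : (0 < Y)%N ->
  \sum_(1 <= t < N.+1) h Y t <= (ln 3 + s + 2 / (s - 1)) * Y%:R.
Proof.
move=> Y0; pose M := maxn N Y.
apply: (@le_trans _ _ (\sum_(1 <= t < M.+1) h Y t)).
  rewrite [leRHS](@big_cat_nat _ _ _ N.+1) ?ltnS ?leq_maxl //=.
  by rewrite lerDl sumr_ge0.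
rewrite (@big_cat_nat _ _ _ Y.+1) ?ltnS ?leq_maxr //=.
have -> : (ln 3 + s + 2 / (s - 1)) * Y%:R =
    (ln 3 *+ Y + s * Y%:R) + 2 * Y%:R / (s - 1) :> R.
  by rewrite -mulr_natr; ring.
apply: lerD.
  apply: (@le_trans _ _
      (\sum_(1 <= t < Y.+1) (ln 3 + s * (ln Y%:R - ln t%:R)))).
    by apply: ler_sum_nat => t; exact: ln_weight_leq.
  rewrite big_split /= sumr_const_nat subSS subn0 lerD2l -big_distrr /=.
  by rewrite ler_wpM2l ?sum_ln_ratio_leq.
apply: (@le_trans _ _
    (2 * Y%:R `^ s * \sum_(Y.+1 <= t < M.+1) t%:R `^ (- s))).
  rewrite big_distrr /=; apply: ler_sum => t _; apply: le_ln1Dx.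
  by rewrite (@lt_le_trans _ _ 0) ?ltrN10 // !mulr_ge0 ?powR_ge0.
apply: le_trans (ler_wpM2l _ (sum_powR_tail_leq M s_gt1 Y0)) _.
  by rewrite mulr_ge0 ?powR_ge0.
have E : Y%:R `^ s * Y%:R `^ (1 - s) = Y%:R :> R.
  rewrite -powRD; last by rewrite pnatr_eq0 -lt0n Y0 implybT.
  by rewrite addrCA subrr addr0 powRr1.
set P := Y%:R `^ s in E *; set W := Y%:R `^ _ in E *.
by rewrite -E le_eqVlt; apply/orP; left; apply/eqP; ring.
Qed.

Lemma sum_omega_expR_leq (m : nat) Y N : (1 < m)%N -> (0 < Y)%N ->
  \sum_(1 <= n < N.+1) (Y%:R `^ s) ^+ size (primes n) * n%:R `^ (- s) <=
  expR (m%:R * (ln 3 + s * ln Y%:R) +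
        ln 16 / ln m%:R * ((ln 3 + s + 2 / (s - 1)) * Y%:R)).
Proof.
move=> m1 Y0; apply: le_trans (sum_omega_prod_leq N _ (ltW s_gt1)) _.
  exact: powR_ge0.
have -> : \prod_(1 <= p < N.+1 | prime p) (1 + 2 * Y%:R `^ s * p%:R `^ (- s)) =
    expR (\sum_(1 <= p < N.+1 | prime p) h Y p).
  rewrite expR_sum; apply: eq_bigr => p _; rewrite lnK // posrE.
  by rewrite ltr_pwDl // !mulr_ge0 ?powR_ge0.
rewrite ler_expR.
apply: le_trans (sum_prime_leq N m1 (@h_decr Y) (@h_ge0 Y)) _.
apply: lerD.
  rewrite ler_wpM2l //; apply: le_trans (@ln_weight_leq Y 1%N _) _.
    by rewrite Y0.
  by rewrite ln1 subr0.
rewrite ler_wpM2l ?sum_ln_weight_leq // divr_ge0 // ln_ge0 ?ler1n // ltnW //.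
Qed.

Lemma sum_omega_weight_leq : exists2 C : R, 0 <= C &
  forall Y N, (16 <= Y)%N ->
  \sum_(1 <= n < N.+1) (Y%:R `^ s) ^+ size (primes n) * n%:R `^ (- s) <=
  expR (C * (Y%:R / ln Y%:R)).
Proof.
have s1 : 0 < s - 1 by rewrite subr_gt0.
pose B : R := ln 3 + s + 2 / (s - 1).
have /andP[l30 l32] : 0 <= (ln 3 : R) <= 2.
  rewrite ln_ge0 ?ler1n //=; have := @le_ln1Dx R 2 ltac:(lra).
  by rewrite (_ : 1 + 2 = 3) //; ring.
have l16 : ln 16 <= 16 :> R.
  have := @le_ln1Dx R 15 ltac:(lra); rewrite (_ : 1 + 15 = 16); last by ring.
  by move/le_trans; apply; rewrite ler_nat.
have B0 : 0 <= B by rewrite !addr_ge0 // divr_ge0 // ltW.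
(* The first summand absorbs [m * (ln 3 + s * ln Y)]. In the second, [64 = 16 * 4] comes from
   [ln 16 <= 16] and [ln Y <= 4 * ln m]. *)
exists (32 * (2 + s) + 64 * B) => [|Y N Y16]; first lra.
(* Primes up to [m ~ sqrt Y] are counted trivially. *)
have [m [m4 mY Ym]] : exists m : nat, [/\ (4 <= m)%N, (m ^ 2 <= Y)%N & (Y <= m ^ 4)%N].
  have ex : exists m : nat, (m ^ 2 <= Y)%N by exists 0%N.
  have ub (m : nat) : (m ^ 2 <= Y)%N -> (m <= Y)%N.
    by apply: leq_trans; rewrite expnS expn1; nia.
  have [m mY mmax] := ex_maxnP ex ub; exists m.
  have m4 : (4 <= m)%N by apply: mmax.
  split => //; have : (Y < m.+1 ^ 2)%N.
    by rewrite ltnNge; apply/negP => /mmax; rewrite ltnn.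
  by rewrite !expnS expn0; nia.
have m1 : (1 < m)%N by exact: leq_trans m4.
have Y0 : (0 < Y)%N by exact: leq_trans Y16.
apply: le_trans (sum_omega_expR_leq N m1 Y0) _; rewrite ler_expR -/B.
have mR : 0 < m%:R :> R by rewrite ltr0n ltnW.
have YR : 0 < Y%:R :> R by rewrite ltr0n.
set l := ln Y%:R; have l1 : 1 <= l.
  apply: (@le_trans _ _ (ln (2 ^+ 4))); last first.
    by rewrite /l ler_ln ?posrE ?exprn_gt0 // -natrX ler_nat.
  by rewrite lnXn //; have := ln2_geq R; lra.
have lm : l <= 4 * ln m%:R.
  have -> : 4 * ln m%:R = ln (m%:R ^+ 4) :> R by rewrite lnXn // mulr_natl.
  by rewrite /l ler_ln ?posrE ?exprn_gt0 // -natrX ler_nat.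
have lnm : ln m%:R ^+ 2 <= 2 * m%:R :> R.
  have lm0 : 0 <= ln m%:R :> R by rewrite ln_ge0 // ler1n ltnW.
  have := expR_ge1Dxn 1 lm0; rewrite lnK ?posrE //.
  have -> : (2`!)%:R = 2 :> R by [].
  lra.
have mY' : m%:R ^+ 2 <= Y%:R :> R by rewrite -natrX ler_nat.
(* Here [l ^ 2 <= 16 * (ln m) ^ 2 <= 32 * m], while [m ^ 2 <= Y]. *)
have ml : m%:R * l <= 32 * (Y%:R / l).
  rewrite mulrA ler_pdivlMr; last lra.
  have l2 : l ^+ 2 <= 32 * m%:R.
    apply: (@le_trans _ _ ((4 * ln m%:R) ^+ 2)); last by rewrite exprMn; lra.
    by apply: lerXn2r => //; rewrite nnegrE; lra.
  rewrite -mulrA -expr2; apply: (@le_trans _ _ (m%:R * (32 * m%:R))).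
    by rewrite ler_pM2l.
  by rewrite mulrCA -expr2 ler_pM2l.
rewrite [leRHS]mulrDl; apply: lerD.
  apply: (@le_trans _ _ ((2 + s) * (m%:R * l))).
    have -> : (2 + s) * (m%:R * l) = m%:R * ((2 + s) * l) by ring.
    by rewrite ler_pM2l //; lra.
  apply: le_trans (ler_wpM2l _ ml) _; first by lra.
  by rewrite le_eqVlt; apply/orP; left; apply/eqP; ring.
have -> : 64 * B * (Y%:R / l) = 64 / l * (B * Y%:R) by ring.
apply: ler_wpM2r; first by rewrite mulr_ge0 // ltW.
rewrite ler_pdivlMr; last lra.
rewrite mulrAC ler_pdivrMr; last lra.
nra.
Qed.

End OmegaWeight.

(** * Size comparisons for iterated logarithms, and the lower bound for the sum *)

Section IteratedExponential.
Variables (R : realType) (l l2 l3 : R).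
Hypotheses (l3_ge8 : 8 <= l3) (l2E : l2 = expR l3) (lE : l = expR l2).

(** All four bounds come from single terms of the exponential series, the hypothesis on [l3]
    absorbing the constants. *)
Lemma iterated_expR_geq :
  [/\ 4 * l3 + 1 <= l2, l3 ^+ 2 / 2 <= l2, l2 ^+ 2 <= l & l2 <= l / l2].
Proof.
have l3_ge := l3_ge8; have l3_0 : 0 <= l3 by lra.
have h2 : l3 ^+ 2 / 2 + 1 <= l2.
  by rewrite l2E addrC; exact: (expR_ge1Dxn 1 l3_0).
have h2' : 4 * l3 + 1 <= l2 by rewrite expr2 in h2; nra.
have l2_0 : 0 <= l2 by lra.
have h1 : 1 + l2 ^+ 3 / 6 <= l by rewrite lE; exact: (expR_ge1Dxn 2 l2_0).
have h1' : l2 ^+ 2 <= l.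
  apply: le_trans h1.
  have -> : l2 ^+ 3 / 6 = l2 ^+ 2 * (l2 / 6) by ring.
  have := sqr_ge0 l2; nra.
split=> //; first by lra.
by rewrite ler_pdivlMr -?expr2 // l2E expR_gt0.
Qed.

(** With [K = l / l2] and [k] primes, [k + 1 > 2 K] would give [k >= 3/2 K], and then
    [ln k! >= 3/2 K (l2 - l3 - 1) > K l2 = l], against [k! <= n]. The constant [2] only costs a
    bounded term in [ln (k + 1)]. *)
Lemma omega_leq (n : nat) :
  (0 < n)%N -> n%:R <= expR l -> (size (primes n)).+1%:R <= 2 * (l / l2).
Proof.
move=> n0 nx; have l3_ge := l3_ge8.
have [h2 _ h1 hK] := iterated_expR_geq.
have l2_0 : 0 < l2 by rewrite l2E expR_gt0.
have l_0 : 0 < l by rewrite lE expR_gt0.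
have E : l / l2 * l2 = l by rewrite divfK // gt_eqF.
have lKE : ln (l / l2) = l2 - l3.
  by rewrite ln_div ?posrE // lE l2E !expRK.
move: (l / l2) hK E lKE => K hK E lKE.
move: (size _) (fact_omega_leq n0) => k fk.
rewrite leNgt; apply/negP; rewrite -natr1 => kK.
have k15 : 3 / 2 * K <= k%:R by lra.
have K0 : 0 < K by lra.
have k0 : (0 : R) < k%:R by lra.
have lnk : l2 - l3 <= ln k%:R by rewrite -lKE ler_ln ?posrE //; lra.
have lfk : ln (k`!)%:R <= l.
  rewrite -ler_expR lnK ?posrE ?ltr0n ?fact_gt0 //; apply: le_trans nx.
  by rewrite ler_nat.
have lk := ln_fact_geq R k.
have u1 : k%:R * (l2 - l3 - 1) <= l.
  apply: le_trans lfk; apply: le_trans lk.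
  by have := ler_wpM2l (ltW k0) lnk; lra.
have u2 : 3 / 2 * K * (l2 - l3 - 1) <= k%:R * (l2 - l3 - 1).
  by apply: ler_wpM2r => //; lra.
have u3 : K * (l2 - 3 * l3 - 3) <= 0 by rewrite -E in u1; lra.
have : 0 < K * (l2 - 3 * l3 - 3) by apply: mulr_gt0 => //; lra.
by rewrite ltNge u3.
Qed.

Lemma sum_G_powR_geq (b : R) : 0 < b ->
  expR (b * (l - l / l2 * (l3 + 8))) <=
  \sum_(1 <= n < (Num.truncn (expR l)).+1) (G n)%:R `^ b.
Proof.
move=> b0; have l3_ge := l3_ge8; have [h2 _ h1 hK] := iterated_expR_geq.
have l2_0 : 0 < l2 by lra.
have l_0 : 0 < l by rewrite lE expR_gt0.
(* Chebyshev gives [primepi w >= N * ln 2 / ln w], so [N > 2 l] and [ln 2 >= 1/2] ensure at least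
   [l / ln w] primes up to [w]. *)
pose N := (Num.truncn (2 * l)).+1; pose w := N.*2.
have N_gt : 2 * l < N%:R by exact: truncnS_gt.
have N_le : N%:R <= 2 * l + 1.
  by rewrite /N -natr1 lerD2r truncn_le; lra.
have wE : w%:R = 2 * N%:R :> R by rewrite /w -mul2n natrM.
have w_gt0 : 0 < w%:R :> R by lra.
have l_ge1 : 1 <= l by nra.
have lw_ge : l2 <= ln w%:R.
  by rewrite -ler_expR -lE lnK ?posrE //; lra.
have lw_le : ln w%:R <= l2 + 4.
  apply: (@le_trans _ _ (ln (5 * l))).
    by rewrite ler_ln ?posrE ?wE; nra.
  rewrite lnM ?posrE // lE expRK addrC lerD2l.
  have := @le_ln1Dx R 4 ltac:(lra); rewrite (_ : 1 + 4 = 5) //; ring.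
have lw0 : 0 < ln w%:R :> R by lra.
have lnw : ln (ln w%:R) <= l3 + 1.
  apply: (@le_trans _ _ (ln (2 * l2))).
    by rewrite ler_ln ?posrE; nra.
  rewrite lnM ?posrE // l2E expRK addrC lerD2l.
  have := @le_ln1Dx R 1 ltac:(lra); rewrite (_ : 1 + 1 = 2) //; ring.
(* The largest [k] with [w ^ k <= expR l], so that a product of [k] primes up to [w] stays in
   range. *)
pose k := Num.truncn (l / ln w%:R).
have q0 : 0 <= l / ln w%:R by rewrite divr_ge0 // ltW.
have k_le : k%:R <= l / ln w%:R by rewrite truncn_le.
have k_gt : l / ln w%:R < k%:R + 1 by rewrite natr1 truncnS_gt.
have k_pi : (k <= primepi w)%N.
  rewrite -(ler_nat R); apply: le_trans k_le _.
  have /(_ isT) := @exp2_leq_primepi N; rewrite -/w -(ler_nat R) !natrX => le.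
  have : ln (2 ^+ N) <= ln (w%:R ^+ primepi w) :> R.
    by rewrite ler_ln ?posrE ?exprn_gt0.
  rewrite !lnXn // -[ln 2 *+ _]mulr_natl -[ln w%:R *+ _]mulr_natl.
  rewrite ler_pdivrMr //; apply: le_trans.
  have := ln2_geq R => ln2; nra.
pose ps := take k (seq.filter prime (iota 0 w.+1)).
have ps_size : size ps = k by rewrite size_takel.
have ps_uniq : uniq ps by rewrite take_uniq // filter_uniq // iota_uniq.
have ps_prime : all prime ps.
  by apply/allP => p /mem_take; rewrite mem_filter => /andP[].
pose n := (\prod_(p <- ps) p)%N.
have n_gt0 : (0 < n)%N.
  by rewrite /n big_seq prodn_cond_gt0 // => p /(allP ps_prime)/prime_gt0.
have n_le : (n <= w ^ k)%N.
  have : all (fun p => p <= w)%N ps.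
    by apply/allP => p /mem_take; rewrite mem_filter mem_iota => /and3P[].
  rewrite /n -ps_size; move: ps {ps_size ps_uniq ps_prime n n_gt0} => s.
  elim: s => [|p s IH] /=; first by rewrite big_nil.
  by case/andP=> pw /IH; rewrite big_cons expnS; exact: leq_mul.
have n_lex : n%:R <= expR l.
  apply: (@le_trans _ _ (w%:R ^+ k)); first by rewrite -natrX ler_nat.
  rewrite -[w%:R]lnK ?posrE // -expRM_natl ler_expR.
  by rewrite -ler_pdivlMr.
have -> : \sum_(1 <= n < (Num.truncn (expR l)).+1) (G n)%:R `^ b =
    (G n)%:R `^ b + \sum_(1 <= m < (Num.truncn (expR l)).+1 | m != n)
      (G m)%:R `^ b.
  rewrite (bigD1_seq n) ?iota_uniq //= mem_index_iota n_gt0 ltnS.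
  by rewrite truncn_ge_nat // expR_ge0.
apply: (@le_trans _ _ ((G n)%:R `^ b)); last first.
  by rewrite lerDl sumr_ge0 // => m _; exact: powR_ge0.
apply: (@le_trans _ _ ((k`!)%:R `^ b)); last first.
  apply: ge0_ler_powR; rewrite ?nnegrE ?ler0n //; first exact: ltW.
  by rewrite ler_nat -{1}ps_size; exact: fact_leq_G.
rewrite /powR gt_eqF ?ltr0n ?fact_gt0 // ler_expR ler_pM2l //.
apply: le_trans (ln_fact_geq R k).
have E : l / l2 * l2 = l by rewrite divfK // gt_eqF.
have qK : l / l2 - 4 * (l / l2 / l2) <= l / ln w%:R.
  apply: (@le_trans _ _ (l / (l2 + 4))).
    rewrite ler_pdivlMr; last lra.
    rewrite -{3}E -subr_ge0; set K := l / l2; rewrite /K.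
    have -> : l / l2 * l2 - (l / l2 - 4 * (l / l2 / l2)) * (l2 + 4) =
      16 * (l / l2 / l2) by field; rewrite gt_eqF.
    by rewrite !mulr_ge0 ?invr_ge0 // ltW.
  by rewrite ler_pM2l // lef_pV2 // posrE; lra.
have JE : l / l2 / l2 * l2 = l / l2 by rewrite divfK // gt_eqF.
have ln_q : ln (l / ln w%:R / 2) = l2 - ln (ln w%:R) - ln 2.
  by rewrite !ln_div ?posrE ?divr_gt0 // {1}lE expRK.
have ln2 : ln 2 <= 1 :> R.
  by have := @le_ln1Dx R 1 ltac:(lra); rewrite (_ : 1 + 1 = 2) //; ring.
have K_ge := hK.
move: k_le k_gt qK ln_q JE E K_ge; move: (l / ln w%:R) => q.
have : 0 <= l / l2 / l2 by rewrite !divr_ge0 // ltW.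
move: (l / l2 / l2) => J J0; move: (l / l2) => K k_le k_gt qK ln_q JE E K_ge.
have JK : 33 * J <= K.
  by rewrite -JE mulrC; apply: ler_wpM2l => //; lra.
have q_ge : q / 2 <= k%:R by lra.
have q_gt0 : 0 < q by lra.
have k_gt0 : 0 < k%:R :> R by lra.
have lnk : l2 - l3 - 2 <= ln k%:R.
  apply: (@le_trans _ _ (ln (q / 2))); first by lra.
  by rewrite ler_ln ?posrE //; lra.
have A1 : k%:R * (l2 - l3 - 3) <= k%:R * ln k%:R - k%:R.
  by have := ler_wpM2l (ltW k_gt0) lnk; lra.
apply: le_trans A1.
(* The constant [8] of the statement is [3 + 4 + 1]: expanding costs [3 K], then [4 J l2 = 4 K],
   then [l2 <= K]. *)
apply: (@le_trans _ _ ((K - 4 * J - 1) * (l2 - l3 - 3))); last first.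
  by apply: ler_wpM2r; lra.
rewrite -E; nra.
Qed.

End IteratedExponential.

(** * The upper bound by Rankin's method *)

Section UpperBound.
Variable R : realType.
Implicit Types b s d : R.

Local Notation weight s Y n :=
  ((Y%:R `^ s) ^+ size (primes n) * n%:R `^ (- s)).

Lemma weightE s (Y n : nat) : (0 < Y)%N -> (0 < n)%N ->
  weight s Y n = expR (s * ((size (primes n))%:R * ln Y%:R) - s * ln n%:R).
Proof.
move=> Y0 n0; rewrite /powR !gt_eqF ?ltr0n // -expRM_natl -expRD.
by congr expR; ring.
Qed.

Lemma G_powR_leq_expR b (n : nat) : 0 <= b ->
  (G n)%:R `^ b <=
  expR (b * ((size (primes n))%:R * ln (size (primes n)).+1%:R)).
Proof.
move=> b0; set k := size _; set v := k.+1%:R : R.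
have -> : expR (b * (k%:R * ln v)) = (v ^+ k) `^ b.
  by rewrite /powR gt_eqF ?exprn_gt0 // lnXn // mulr_natl.
apply: ge0_ler_powR; rewrite ?nnegrE ?ler0n ?exprn_ge0 //.
by rewrite -natrX ler_nat G_leq.
Qed.

(* Integers with at least [(1 - d) * l / l2] prime factors gain a factor
   [expR (l3 - 1)] from each of them when [k + 1 <= 2 * l / l2] is compared with
   [Y ~ l]; for the others a smaller exponent [s < b] already wins. *)
Lemma G_powR_leq_weight (l l2 l3 : R) b s d (n : nat) (Y := (Num.truncn l).+1) :
  8 <= l3 -> l2 = expR l3 -> l = expR l2 -> 0 < s -> s < b ->
  (0 < n)%N -> n%:R <= expR l ->
  (G n)%:R `^ b <=
    weight b Y n * expR (b * l - b * (1 - d) * (l / l2 * (l3 - 1))) +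
    weight s Y n * expR (s * l + (b - s) * ((1 - d) * l)).
Proof.
move=> l3_ge l2E lE s0 sb n0 nx.
have [h2 _ h1 hK] := iterated_expR_geq l3_ge l2E lE.
have l2_0 : 0 < l2 by lra.
have l_0 : 0 < l by rewrite lE expR_gt0.
have ko := omega_leq l3_ge l2E lE n0 nx.
apply: le_trans (G_powR_leq_expR n _) _; first by lra.
rewrite !weightE //.
have nl : ln n%:R <= l by rewrite -ler_expR lnK // posrE ltr0n.
have lY : l2 <= ln Y%:R.
  rewrite -ler_expR -lE lnK ?posrE ?ltr0n //; exact/ltW/truncnS_gt.
have lk0 : 0 <= ln (size (primes n)).+1%:R :> R by rewrite ln_ge0 // ler1n.
have lk : ln (size (primes n)).+1%:R <= l2 - (l3 - 1).
  apply: (@le_trans _ _ (ln (2 * (l / l2)))).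
    by rewrite ler_ln ?posrE ?ltr0n // mulr_gt0 // divr_gt0.
  rewrite lnM ?posrE ?divr_gt0 // ln_div ?posrE // lE l2E !expRK.
  have := @le_ln1Dx R 1 ltac:(lra); rewrite (_ : 1 + 1 = 2) //; lra.
have E : l / l2 * l2 = l by rewrite divfK // gt_eqF.
have K0 : 0 < l / l2 by rewrite divr_gt0.
move: (l / l2) E K0 {ko hK} => K E K0.
move: (ln _.+1%:R) lk lk0 => L1 lk lk0.
move: (ln Y%:R) lY => LY lY; move: (ln n%:R) nl => ln_n nl.
have k0 : 0 <= (size (primes n))%:R :> R by [].
move: ((size (primes n))%:R : R) k0 => k k0.
rewrite -!expRD.
have [kK|/ltW kK] := leP ((1 - d) * K) k.
  rewrite -[leLHS]addr0; apply: lerD (expR_ge0 _); rewrite ler_expR.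
  have a1 : k * L1 <= k * (LY - (l3 - 1)) by apply: ler_wpM2l => //; lra.
  have a2 : (1 - d) * K * (l3 - 1) <= k * (l3 - 1).
    by apply: ler_wpM2r => //; lra.
  have b0 : 0 <= b by lra.
  have a3 : b * (k * L1) <= b * (k * LY - (1 - d) * K * (l3 - 1)).
    by apply: ler_wpM2l => //; lra.
  (* Rankin's trick: [(expR l / n) ^ b >= 1] for [n] in range. *)
  have a4 : 0 <= b * (l - ln_n) by apply: mulr_ge0 => //; lra.
  lra.
rewrite -[leLHS]add0r; apply: lerD (expR_ge0 _) _; rewrite ler_expR.
have a1 : s * (k * L1) <= s * (k * LY).
  by apply: ler_wpM2l; [lra|apply: ler_wpM2l => //; lra].
have a2 : k * L1 <= (1 - d) * l.
  apply: (@le_trans _ _ (k * l2)); first by apply: ler_wpM2l => //; lra.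
  by rewrite -E mulrA; apply: ler_wpM2r => //; lra.
have a3 : (b - s) * (k * L1) <= (b - s) * ((1 - d) * l).
  by apply: ler_wpM2l => //; lra.
have a4 : 0 <= s * (l - ln_n) by apply: mulr_ge0; lra.
lra.
Qed.

Lemma sum_G_powR_leq b eps : 1 < b -> 0 < eps -> exists2 A : R, 8 <= A &
  forall l l2 l3 : R, A <= l3 -> l2 = expR l3 -> l = expR l2 ->
  \sum_(1 <= n < (Num.truncn (expR l)).+1) (G n)%:R `^ b <=
  expR (b * l - (b - eps) * (l / l2 * l3)).
Proof.
(* Any [s] strictly between [1] and [b] makes the second Rankin sum available; [d] is such that
   discarding the fraction [d] of the primes costs only [eps / 2]. *)
move=> b1 eps0; pose s := (1 + b) / 2; pose d := eps / (2 * b).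
have b0 : 0 < b by lra.
have s1 : 1 < s by rewrite /s; lra.
have sb : s < b by rewrite /s; lra.
have d0 : 0 < d by rewrite divr_gt0 ?mulr_gt0.
have bd : b * d = eps / 2 by rewrite /d; field; rewrite gt_eqF.
have [Cb Cb0 sumb] := sum_omega_weight_leq b1.
have [Cs Cs0 sums] := sum_omega_weight_leq s1.
clearbody s d.
have kap0 : 0 < (b - s) * d by rewrite mulr_gt0 // subr_gt0.
(* The summands give, in order, [8 <= l3], [c1], [c3] and [c2]: [c1] absorbs the [O(l / l2)] errors
   of the first term, [c2] and [c3] serve the second. *)
pose A := 8 + (2 * Cb + b + 1) * 2 / eps + (2 * Cs + 1) +
  (b + 1) * 2 / ((b - s) * d).
have A1 : 0 <= (2 * Cb + b + 1) * 2 / eps.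
  by rewrite divr_ge0 ?mulr_ge0 //; lra.
have A2 : 0 <= (b + 1) * 2 / ((b - s) * d).
  by rewrite divr_ge0 ?mulr_ge0 //; lra.
exists A => [|l l2 l3 l3A l2E lE]; first by rewrite /A; lra.
have l3_ge : 8 <= l3 by move: l3A; rewrite /A; lra.
have c1 : 2 * Cb + b + 1 <= eps / 2 * l3.
  have : (2 * Cb + b + 1) * 2 / eps <= l3 by move: l3A; rewrite /A; lra.
  rewrite ler_pdivrMr //; lra.
have c2 : b + 1 <= (b - s) * d * (l3 / 2).
  have : (b + 1) * 2 / ((b - s) * d) <= l3 by move: l3A; rewrite /A; lra.
  rewrite ler_pdivrMr //; lra.
have c3 : 2 * Cs + 1 <= l3 by move: l3A; rewrite /A; lra.
have [h2 h2q h1 hK] := iterated_expR_geq l3_ge l2E lE.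
have l2_0 : 0 < l2 by lra.
have l_0 : 0 < l by rewrite lE expR_gt0.
pose Y := (Num.truncn l).+1; pose N := Num.truncn (expR l).
have YR : l <= Y%:R <= l + 1.
  by rewrite ltW ?truncnS_gt //= /Y -natr1 lerD2r truncn_le ltW.
have /andP[lY Yl] := YR.
have l16 : 16 <= l by rewrite expr2 in h1; nra.
have Y16 : (16 <= Y)%N by rewrite -(ler_nat R) (le_trans l16).
have E : l / l2 * l2 = l by rewrite divfK // gt_eqF.
have YK : Y%:R / ln Y%:R <= 2 * (l / l2).
  have lYge : l2 <= ln Y%:R by rewrite -ler_expR -lE lnK ?posrE ?ltr0n.
  rewrite ler_pdivrMr; last exact: lt_le_trans lYge.
  apply: (@le_trans _ _ (2 * (l / l2) * l2)); first by rewrite -mulrA E; lra.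
  by apply: ler_wpM2l => //; rewrite mulr_ge0 ?divr_ge0 ?ltW.
pose eb := b * l - b * (1 - d) * (l / l2 * (l3 - 1)).
pose es := s * l + (b - s) * ((1 - d) * l).
apply: (@le_trans _ _ (\sum_(1 <= n < N.+1)
    (weight b Y n * expR eb + weight s Y n * expR es))).
  apply: ler_sum_nat => n /andP[n0 nN]; apply: G_powR_leq_weight => //.
    by lra.
  by rewrite -truncn_ge_nat ?expR_ge0.
rewrite big_split /= -!big_distrl /=.
apply: (@le_trans _ _
    (expR (Cb * (2 * (l / l2)) + eb) + expR (Cs * (2 * (l / l2)) + es))).
  rewrite !expRD; apply: lerD; apply: ler_wpM2r; rewrite ?expR_ge0 //.
    by apply: le_trans (sumb _ _ Y16) _; rewrite ler_expR ler_wpM2l.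
  by apply: le_trans (sums _ _ Y16) _; rewrite ler_expR ler_wpM2l.
rewrite /eb /es.
have K1 : 1 <= l / l2 by lra.
move: (l / l2) E K1 {hK YK eb es} => K E K1.
set F := (X in _ <= expR X).
(* A margin of [1] in each exponent pays for adding two exponentials, as [2 <= expR 1]. *)
suff [f1 f2] : Cb * (2 * K) + (b * l - b * (1 - d) * (K * (l3 - 1))) <= F - 1 /\
    Cs * (2 * K) + (s * l + (b - s) * ((1 - d) * l)) <= F - 1.
  have half : 2 * expR (F - 1) <= expR F.
    have := expR_ge1Dx (1 : R); rewrite (_ : 1 + 1 = 2); last by ring.
    have -> : expR F = expR (F - 1) * expR 1 by rewrite -expRD subrK.
    by move=> e2; rewrite mulrC; apply: ler_wpM2l => //; exact: expR_ge0.
  apply: le_trans half; rewrite [leRHS]mulr_natl mulr2n.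
  by apply: lerD; rewrite ler_expR.
have K0 : 0 <= K by lra.
rewrite /F; split.
  have -> : b * (1 - d) = b - eps / 2 by rewrite mulrBr mulr1 bd.
  have := ler_wpM2l K0 c1; have := mulr_ge0 K0 (ltW eps0); lra.
(* The smaller exponent saves [(b - s) * d * l], a constant multiple of [K * l2]; it outweighs
   [K * l3] because [l2 >= l3 ^ 2 / 2]. *)
have g1 : (b + 1) * l3 <= (b - s) * d * l2.
  apply: (@le_trans _ _ ((b - s) * d * (l3 / 2) * l3)).
    by apply: ler_wpM2r => //; lra.
  rewrite -[leLHS]mulrA ler_pM2l //; rewrite expr2 in h2q; lra.
have g2 : (2 * Cs + 1 + b * l3) * K <= (b - s) * d * l.
  rewrite -E (mulrC K) mulrA; apply: ler_wpM2r => //; lra.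
have g3 : 0 <= eps * (K * l3) by rewrite !mulr_ge0 //; lra.
lra.
Qed.

End UpperBound.

(** * Passage to the asymptotic statement *)

Lemma near_iterated_ln (R : realType) (A : R) (P : R -> Prop) :
  (forall l l2 l3 : R, A <= l3 -> l2 = expR l3 -> l = expR l2 -> P (expR l)) ->
  \forall x \near +oo, P x.
Proof.
move=> h; apply: filterS (nbhs_pinfty_ge (num_real (expR (expR (expR A))))) => x.
have le_ln (a u : R) : expR a <= u -> 0 < u /\ a <= ln u.
  move=> au; have u0 : 0 < u by apply: lt_le_trans au; exact: expR_gt0.
  by split=> //; rewrite -ler_expR lnK.
move=> /le_ln[x0 /le_ln[l0 /le_ln[l2_0 l3A]]].
rewrite -[x]lnK ?posrE //.
by apply: (h _ (ln (ln x)) (ln (ln (ln x)))); rewrite // lnK.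
Qed.

Lemma ln_sum_G_powR (R : realType) (b eps : R) : 1 < b -> 0 < eps ->
  \forall x \near +oo,
    0 < \sum_(1 <= n < (Num.truncn x).+1) (G n)%:R `^ b /\
    `|ln ((\sum_(1 <= n < (Num.truncn x).+1) (G n)%:R `^ b) / x `^ b) +
      b * (ln x * logk 3 x / logk 2 x)| <= eps * (ln x * logk 3 x / logk 2 x).
Proof.
move=> b1 eps0; have b0 : 0 < b by lra.
have [A A8 le] := sum_G_powR_leq b1 eps0.
(* The extra [8 * b / eps] makes the error [8 * b * K] of the lower bound at most [eps * K * l3]. *)
apply: (@near_iterated_ln _ (A + 8 * b / eps)) => l l2 l3 l3A l2E lE.
have B0 : 0 <= 8 * b / eps by rewrite divr_ge0 ?mulr_ge0 // ltW.
have l3_ge : 8 <= l3 by lra.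
have c1 : 8 * b <= eps * l3 by rewrite [leRHS]mulrC -ler_pdivrMr //; lra.
have {}le := le l l2 l3 ltac:(lra) l2E lE.
have ge := sum_G_powR_geq l3_ge l2E lE b0.
set T := \sum_(_ <= _ < _) _ in le ge *; clearbody T.
have T0 : 0 < T by apply: lt_le_trans ge; exact: expR_gt0.
split=> //; rewrite /logk /= expRK.
have -> : ln l = l2 by rewrite lE expRK.
have -> : ln l2 = l3 by rewrite l2E expRK.
have -> : l * l3 / l2 = l / l2 * l3 by ring.
have [_ _ _ hK] := iterated_expR_geq l3_ge l2E lE.
have K0 : 0 <= l / l2 by apply: le_trans hK; rewrite l2E expR_ge0.
move: (l / l2) K0 le ge {hK} => K K0.
move=> le ge.
have {}le : ln T <= b * l - (b - eps) * (K * l3) by rewrite -ler_expR lnK.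
have {}ge : b * (l - K * (l3 + 8)) <= ln T by rewrite -ler_expR lnK.
rewrite ln_div ?posrE ?powR_gt0 ?expR_gt0 // ln_powR expRK.
have c2 := ler_wpM2l K0 c1.
by rewrite ler_norml; apply/andP; split; lra.
Qed.

Theorem theorem1p7 (R : realType) (beta : R) (hbeta : 1 < beta) :
  exists e : R -> R,
    e x @[x --> +oo] --> (0 : R) /\
    \forall x \near +oo,
      \sum_(1 <= n < (Num.truncn x).+1) (G n)%:R `^ beta
        = x `^ beta / L x `^ (beta + e x).
Proof.
pose T (x : R) := \sum_(1 <= n < (Num.truncn x).+1) (G n)%:R `^ beta.
pose D (x : R) := ln x * logk 3 x / logk 2 x.
have D_gt0 : \forall x \near +oo, 0 < D x.
  apply: (@near_iterated_ln _ 8) => l l2 l3 l3_ge l2E lE.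
  rewrite /D /logk /= expRK; have -> : ln l = l2 by rewrite lE expRK.
  have -> : ln l2 = l3 by rewrite l2E expRK.
  by rewrite divr_gt0 ?mulr_gt0 ?lE ?l2E ?expR_gt0 // (lt_le_trans _ l3_ge).
(* This [e] solves the required equation wherever [T x], [D x] and [x] are positive; its limit is
   the content of [ln_sum_G_powR]. *)
exists (fun x => - beta - ln (T x / x `^ beta) / D x); split.
  apply/cvgr0Pnorm_le => eps eps0.
  apply: filterS2 (ln_sum_G_powR hbeta eps0) D_gt0 => x [_ le] D0.
  have -> : - beta - ln (T x / x `^ beta) / D x =
      - ((ln (T x / x `^ beta) + beta * D x) / D x).
    by field; rewrite gt_eqF.
  by rewrite normrN normrM normfV (gtr0_norm D0) ler_pdivrMr.
apply: filterS3 (ln_sum_G_powR hbeta ltr01) D_gt0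
  (nbhs_pinfty_gt (num_real (0 : R))) => x [T0 _] D0 x0.
have LE : L x = expR (D x) by [].
rewrite addrA subrr add0r -/(T x) LE -expRM mulrN (mulrC (D x)).
rewrite divfK ?gt_eqF // expRN lnK; last by rewrite posrE divr_gt0 ?powR_gt0.
by rewrite invrK mulrC divfK // gt_eqF ?powR_gt0.
Qed.
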